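(* Let $q=(1+uy)/(1+y)$. For $n\ge0$ let $a_n(u,y;\alpha)=\sum_D u^{\operatorname{des}(D)}y^{e(D)}\alpha^{\operatorname{so}(D)}$, the sum over all acyclic digraphs $D$ on $[n]$, and $a_n(u,y)=a_n(u,y;1)$. Let \[A(x)=\sum_{n\ge0}a_n(u,y)\frac{x^n}{n!_q(1+y)^{\binom n2}}.\] Then \[A(x)=\Bigl(\sum_{n\ge0}(-1)^n\frac{x^n}{n!_q(1+y)^{\binom n2}}\Bigr)^{-1},\] and more generally \[\sum_{n\ge0}a_n(u,y;\alpha)\frac{x^n}{n!_q(1+y)^{\binom n2}}=\Bigl(\sum_{n\ge0}(\alpha-1)^n\frac{x^n}{n!_q(1+y)^{\binom n2}}\Bigr)\Bigm/\Bigl(\sum_{n\ge0}(-1)^n\frac{x^n}{n!_q(1+y)^{\binom n2}}\Bigr).\]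
   Context: Series are formal power series in $x$ with coefficients in $\mathbb{Q}(u,y,\alpha)$. A digraph on a finite set $V$ of integers is a set $E\subseteq V\times V$ of ordered pairs $(s,t)$ with $s\ne t$ (edges); it is acyclic if it has no nonempty directed path from a vertex to itself. $e(D)$ is the number of edges, $\operatorname{des}(D)$ the number of descents (edges $(s,t)$ with $s>t$), $\operatorname{so}(D)$ the number of sources (vertices of in-degree $0$). $a_0=1$. $n!_q=\prod_{k=1}^n(1+q+\cdots+q^{k-1})$. *)

(* Defs.v *)
From HB Require Import structures.
From mathcomp Require Import all_boot all_order all_algebra.
From mathcomp Require Import mpoly.
Set Implicit Arguments. Unset Strict Implicit. Unset Printing Implicit Defensive.
Import Order.TTheory GRing.Theory Num.Theory.
Local Open Scope ring_scope.

(* A formal power series in x over K is its coefficient sequence, so equality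
   of series is pointwise equality [=1]. *)
Section FormalPowerSeries.
Variable K : fieldType.
Implicit Types f g : nat -> K.

Definition fps_one : nat -> K := fun n => (n == 0)%:R.

Definition fps_mul f g : nat -> K :=
  fun n => \sum_(i < n.+1) f i * g (n - i)%N.

(* Coefficients 0, ..., n of 1 / f, solved recursively from f * (1 / f) = 1;
   meaningful when f 0 != 0, see fps_mulV and fps_inv_unique. *)
Fixpoint fps_inv_coefs f (n : nat) : seq K :=
  if n is m.+1 then
    let s := fps_inv_coefs f m in
    rcons s (- (f 0)^-1 * \sum_(i < m.+1) f (m.+1 - i)%N * s`_i)
  else [:: (f 0)^-1].

Definition fps_inv f : nat -> K := fun n => (fps_inv_coefs f n)`_n.

Definition fps_div f g : nat -> K := fps_mul f (fps_inv g).

Lemma size_fps_inv_coefs f n : size (fps_inv_coefs f n) = n.+1.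
Proof. by elim: n => //= n IHn; rewrite size_rcons IHn. Qed.

Lemma nth_fps_inv_coefs f n i :
  (i <= n)%N -> (fps_inv_coefs f n)`_i = fps_inv f i.
Proof.
elim: n i => [|n IHn] i; first by rewrite leqn0 => /eqP->.
rewrite leq_eqVlt => /predU1P[->//|lt_in].
by rewrite /= nth_rcons size_fps_inv_coefs lt_in IHn.
Qed.

Lemma fps_invS f n :
  fps_inv f n.+1 =
    - (f 0)^-1 * \sum_(i < n.+1) f (n.+1 - i)%N * fps_inv f i.
Proof.
rewrite {1}/fps_inv /= nth_rcons size_fps_inv_coefs ltnn eqxx.
by congr (_ * _); apply: eq_bigr => i _; rewrite nth_fps_inv_coefs // -ltnS.
Qed.

Lemma fps_mulC f g : fps_mul f g =1 fps_mul g f.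
Proof.
move=> n; rewrite /fps_mul (reindex_inj rev_ord_inj) /=.
apply: eq_bigr => i _; have le_in : (i <= n)%N by rewrite -ltnS.
by rewrite subSS (subKn le_in); exact: mulrC.
Qed.

Lemma fps_mulV f : f 0 != 0 -> fps_mul f (fps_inv f) =1 fps_one.
Proof.
move=> f0 n; rewrite fps_mulC /fps_mul big_ord_recr /= subnn.
case: n => [|n]; first by rewrite big_ord0 add0r mulVf.
rewrite fps_invS mulrAC mulNr mulVf // mulN1r.
rewrite -sumrN -big_split big1 // => i _ /=.
by rewrite [X in X - _]mulrC subrr.
Qed.

Lemma fps_inv_unique f g :
  f 0 != 0 -> fps_mul f g =1 fps_one -> g =1 fps_inv f.
Proof.
move=> f0 fg; have gf n : fps_mul g f n = fps_one n by rewrite fps_mulC.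
move=> n; elim/ltn_ind: n => n IHn.
have := gf n; rewrite -(fps_mulV f0 n) [in RHS]fps_mulC /fps_mul.
rewrite !big_ord_recr /= subnn (eq_bigr (fun i : 'I_n => fps_inv f i * f (n - i)%N)).
  by move/addrI/(mulIf f0).
by move=> i _; rewrite IHn.
Qed.

End FormalPowerSeries.

(* Digraphs on [n], with vertex set 'I_n = {0, ..., n-1} in place of
   {1, ..., n}; only the order of the vertices matters. *)
Section Digraphs.
Variable n : nat.
Implicit Type D : {set 'I_n * 'I_n}.

Definition digraph D := [forall e in D, e.1 != e.2].

Definition edge D : rel 'I_n := fun s t => (s, t) \in D.

(* No edge s -> t closes up to a directed cycle; see acyclicP. *)
Definition acyclic D := [forall e in D, ~~ connect (edge D) e.2 e.1].

Lemma acyclicP D :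
  reflect (forall s p, path (edge D) s p -> p != [::] -> last s p != s)
          (acyclic D).
Proof.
apply: (iffP forall_inP) => [acD s [|t p] //= /andP[Dst Dp] _ | acD [s t] Dst /=].
  apply/eqP => last_s; have /negP[] := acD _ Dst.
  by apply/connectP; exists p.
apply/connectP => -[p Dp def_s].
have := acD s (t :: p); rewrite /= -def_s eqxx /edge Dst.
by move/(_ Dp isT).
Qed.

Definition edges D : nat := #|D|.

Definition des D : nat := #|[set e in D | (e.2 < e.1)%N]|.

Definition so D : nat := #|[set t | [forall s, (s, t) \notin D]]|.

End Digraphs.

Definition acyclic_enum (R : comNzRingType) (n : nat) (u y alpha : R) : R :=
  \sum_(D : {set 'I_n * 'I_n} | digraph D && acyclic D)
     u ^+ des D * y ^+ edges D * alpha ^+ so D.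

Definition qfact (R : comNzRingType) (q : R) (n : nat) : R :=
  \prod_(1 <= k < n.+1) \sum_(i < k) q ^+ i.

(* The field Q(u, y, alpha) and its three indeterminates. *)
Definition Quya : fieldType := {fraction {mpoly rat[3]}}.
Definition u_var : Quya := tofrac 'X_(inord 0 : 'I_3).
Definition y_var : Quya := tofrac 'X_(inord 1 : 'I_3).
Definition alpha_var : Quya := tofrac 'X_(inord 2 : 'I_3).

(* The series \sum_n c_n x^n / (n!_q (1 + y)^C(n, 2)). *)
Definition graphic_egf (K : fieldType) (q y : K) (c : nat -> K) : nat -> K :=
  fun n => c n / (qfact q n * (1 + y) ^+ 'C(n, 2)).

(* Main.v *)
(* Write z^so = (1 + (z - 1))^so and expand over the sets S of sources of an
   acyclic digraph D on V. Given S, the edges of D from S to V \ S are arbitrary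
   and the remaining ones form an acyclic digraph on V \ S. The edges from S to
   V \ S contribute a factor 1 + uy for each descending pair and 1 + y for each
   ascending pair; with a = 1 + uy and b = 1 + y, summing this factor over all S
   of given size produces a homogeneous q-binomial coefficient, hence the
   product of two series. At z = 0 the left-hand side is 0 unless V is empty,
   because a nonempty acyclic digraph has a source; this gives the case z = 1,
   from which the general case follows. Working on every V included in 'I_n and
   inducting on the size of V avoids relabelling digraphs. *)
Require Import Defs.
From mathcomp Require Import all_boot all_order all_algebra.
From mathcomp Require Import mpoly.
From mathcomp Require Import ring zify.
Set Implicit Arguments. Unset Strict Implicit. Unset Printing Implicit Defensive.
Import Order.TTheory GRing.Theory Num.Theory.
Local Open Scope ring_scope.

Lemma prod_1D_subset (R : comNzRingType) (I : finType) (E : {set I}) (F : I -> R) :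
  \prod_(i in E) (1 + F i) =
    \sum_(J : {set I} | J \subset E) \prod_(i in J) F i.
Proof.
(* [G] vanishes off [E], so expanding over the whole type kills every subset not contained in
   [E]. *)
pose G i := if i \in E then F i else 0.
transitivity (\prod_i (G i + 1)).
  rewrite big_mkcond; apply: eq_bigr => i _.
  by rewrite /G; case: ifP; rewrite ?add0r // addrC.
rewrite bigA_distr [RHS]big_mkcond; apply: eq_bigr => J _.
rewrite -big_mkcond /=; case: ifPn => [/subsetP sJE | /subsetPn[i Ji nEi]].
  by apply: eq_bigr => i /sJE; rewrite /G => ->.
by rewrite (bigD1 i) //= /G (negPf nEi) mul0r.
Qed.

(** * Sources of acyclic digraphs, and a recurrence over sets of sources *)

Section AcyclicRecurrence.
Variable n : nat.
Implicit Types (D : {set 'I_n * 'I_n}) (S V : {set 'I_n}).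

Lemma acyclic_digraph D : acyclic D -> digraph D.
Proof.
move=> /forall_inP acD; apply/forall_inP => -[s t] /acD /=.
by apply: contraNneq => ->; exact: connect0.
Qed.

Lemma sub_acyclic D D' : D' \subset D -> acyclic D -> acyclic D'.
Proof.
move=> /subsetP sD /forall_inP acD; apply/forall_inP => e De.
apply: contra (acD _ (sD _ De)); apply: connect_sub => x y xy.
by apply: connect1; exact: sD.
Qed.

Definition sources V D := [set t in V | [forall s, (s, t) \notin D]].

Lemma sources_neq0 V D :
  V != set0 -> D \subset setX V V -> acyclic D -> sources V D != set0.
Proof.
case/set0Pn => x0 x0V /subsetP sD /forall_inP acD.
(* A vertex with the fewest ancestors is a source. *)
pose anc x := [set z | connect (edge D) z x].
case: (arg_minnP (fun x => #|anc x|) x0V) => x xV min_x.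
apply/set0Pn; exists x; rewrite inE [x \in V]xV; apply/forallP => s.
apply/negP => Dsx; have /setXP[sV _] := sD _ Dsx.
have /negP := acD _ Dsx; apply => /=.
have sub_anc : anc s \subset anc x.
  apply/subsetP => z; rewrite !inE => /connect_trans; apply.
  exact: connect1.
(* Minimality makes the two ancestor sets equal, so [x] is an ancestor of [s] and the edge from [s]
   to [x] closes a cycle. *)
have /setP/(_ x) : anc s = anc x by apply/eqP; rewrite eqEcard sub_anc min_x.
by rewrite !inE connect0.
Qed.

(** A walk that starts outside [S] never enters it, so it only uses edges of [D']. *)
Lemma connect_out S D D' :
  (forall s t, (s, t) \in D -> s \notin S -> (s, t) \in D' /\ t \notin S) ->
  forall x y, x \notin S -> connect (edge D) x y ->
    connect (edge D') x y /\ y \notin S.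
Proof.
move=> outD x y nSx /connectP[p Dp ->] {y}.
elim: p x nSx Dp => [|z p IHp] x nSx /=; first by rewrite connect0.
case/andP=> Dxz Dp; have [D'xz nSz] := outD _ _ Dxz nSx.
have [D'zl ?] := IHp _ nSz Dp; split=> //.
exact: connect_trans (connect1 _) D'zl.
Qed.

(** A cycle can use no edge of [F], since it would have to return to [S]. *)
Lemma acyclicU_setX S V (F D' : {set 'I_n * 'I_n}) :
    F \subset setX S (V :\: S) -> D' \subset setX (V :\: S) (V :\: S) ->
  acyclic (F :|: D') = acyclic D'.
Proof.
move=> /subsetP sF /subsetP sD'; apply/idP/idP => [|/forall_inP acD'].
  by apply: sub_acyclic; exact: subsetUr.
have outD s t : (s, t) \in F :|: D' -> s \notin S -> (s, t) \in D' /\ t \notin S.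
  case/setUP => [/sF/setXP[/= -> //]|D'st _].
  by have /setXP[_ /setDP[]] := sD' _ D'st.
apply/forall_inP => -[s t] /= /setUP[Fst|D'st].
  have /setXP[/= Ss /setDP[_ nSt]] := sF _ Fst.
  by apply/negP => /(connect_out outD nSt)[_]; rewrite Ss.
have /setXP[_ /setDP[_ /= nSt]] := sD' _ D'st.
apply/negP => /(connect_out outD nSt)[ts _].
by have := acD' _ D'st; rewrite /= ts.
Qed.

Section Weighted.
Variables (R : comNzRingType) (wt : 'I_n * 'I_n -> R).

Definition acyclic_sum V (z : R) : R :=
  \sum_(D : {set 'I_n * 'I_n} | (D \subset setX V V) && acyclic D)
     \prod_(e in D) wt e * z ^+ #|sources V D|.

Lemma acyclic_sum0 V : acyclic_sum V 0 = (V == set0)%:R.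
Proof.
have [->|nzV] := eqVneq.
  rewrite /acyclic_sum (big_pred1 set0) => [|D].
    rewrite big_set0 mul1r.
    by rewrite (_ : sources _ _ = set0) ?cards0 //; apply/setP=> t; rewrite !inE.
  rewrite (_ : setX _ _ = set0) ?subset0; last by apply/setP=> t; rewrite !inE.
  case: eqVneq => [-> | /negPf nD0]; rewrite /= ?eqxx ?nD0 //.
  by apply/forall_inP => e; rewrite inE.
apply: big1 => D /andP[sD acD].
by rewrite expr0n cards_eq0 (negPf (sources_neq0 nzV sD acD)) mulr0.
Qed.

(** No edge enters [S], so [D] is the disjoint union of its edges from [S] to [V :\: S] and those
    inside [V :\: S]. The former are arbitrary, whence the factors [1 + wt e]; the latter form any
    acyclic digraph. *)
Lemma acyclic_sum_sub_sources S V : S \subset V ->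
  \sum_(D : {set 'I_n * 'I_n} |
       [&& D \subset setX V V, acyclic D & S \subset sources V D])
     \prod_(e in D) wt e =
  \prod_(e in setX S (V :\: S)) (1 + wt e) * acyclic_sum (V :\: S) 1.
Proof.
move=> sSV; rewrite prod_1D_subset /acyclic_sum.
rewrite big_distrlr pair_big_dep /=.
pose split D := (D :&: setX S (V :\: S), D :&: setX (V :\: S) (V :\: S)).
have splitK D : [&& D \subset setX V V, acyclic D & S \subset sources V D] ->
    (split D).1 :|: (split D).2 = D.
  case/and3P=> /subsetP sD _ /subsetP srcS; rewrite -setIUr; apply/setIidPl.
  apply/subsetP => -[s t] Dst; have /setXP[/= sV tV] := sD _ Dst.
  have nSt: t \notin S.
    by apply/negP => /srcS; rewrite inE tV => /forallP/(_ s); rewrite Dst.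
  by rewrite !inE /= sV tV nSt; case: (s \in S).
rewrite (reindex_onto (fun p => p.1 :|: p.2) split) //=.
have disj (F D' : {set 'I_n * 'I_n}) : F \subset setX S (V :\: S) ->
    D' \subset setX (V :\: S) (V :\: S) -> [disjoint F & D'].
  move=> /subsetP sF /subsetP sD'; rewrite disjoint_subset.
  apply/subsetP => -[s t] /sF/setXP[/= Ss _]; apply/negP => /sD'.
  by rewrite !inE /= Ss.
have sub_split F D' : split (F :|: D') = (F, D') ->
    F \subset setX S (V :\: S) /\ D' \subset setX (V :\: S) (V :\: S).
  by case=> eqF eqD'; rewrite -{1}eqF -{2}eqD' !subsetIr.
apply: eq_big => [[F D'] | [F D'] /andP[_ /eqP/sub_split[sF sD']]] /=; last first.
  rewrite expr1n mulr1 -bigU ?disj //=.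
  by apply: eq_bigl => e; rewrite !inE.
apply/idP/idP => [/andP[/and3P[_ acU _] /eqP/sub_split[sF sD']] | ].
  by rewrite sF sD' -(acyclicU_setX sF sD').
case/and3P=> sF sD' acD'.
rewrite (acyclicU_setX sF sD') acD' /=.
have [/subsetP psF /subsetP psD'] := (sF, sD').
rewrite -andbA; apply/and3P; split.
- rewrite subUset; apply/andP; split; apply/subsetP => -[s t].
    by move/psF/setXP => [/= /(subsetP sSV) sV /setDP[tV _]]; rewrite inE /= sV.
  by move/psD'/setXP => [/= /setDP[sV _] /setDP[tV _]]; rewrite inE /= sV.
- apply/subsetP => t St; rewrite inE (subsetP sSV) //=; apply/forallP => s.
  by apply/negP => /setUP[/psF|/psD'] /setXP[_ /setDP[_]]; rewrite St.
- apply/eqP; congr (_, _); apply/setP => -[s t]; rewrite !in_setI !in_setU.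
    apply/andP/idP => [[/orP[//|/psD']]|Fst]; last by rewrite Fst psF.
    by rewrite !inE /= => /andP[/andP[/negPf->]].
  apply/andP/idP => [[/orP[/psF|//]]|Dst]; last by rewrite Dst psD' // orbT.
  by rewrite !inE /= => /andP[->].
Qed.

Lemma acyclic_sum_rec V z :
  acyclic_sum V z =
    \sum_(S : {set 'I_n} | S \subset V)
      (z - 1) ^+ #|S| *
      (\prod_(e in setX S (V :\: S)) (1 + wt e) * acyclic_sum (V :\: S) 1).
Proof.
have expand D : \prod_(e in D) wt e * z ^+ #|sources V D| =
    \sum_(S : {set 'I_n} | S \subset sources V D)
      \prod_(e in D) wt e * (z - 1) ^+ #|S|.
  rewrite -mulr_sumr -[in LHS](subrKC 1 z) -prodr_const prod_1D_subset.
  by congr (_ * _); apply: eq_bigr => S _; rewrite prodr_const.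
rewrite {1}/acyclic_sum (eq_bigr _ (fun D _ => expand D)).
rewrite (exchange_big_dep (fun S => S \subset V)) /=; last first.
  by move=> D S _ /subset_trans; apply; apply/subsetP => t; case/setIdP.
apply: eq_bigr => S sSV; rewrite -acyclic_sum_sub_sources // mulr_sumr.
apply: eq_big => [D | D _]; first by rewrite andbA.
exact: mulrC.
Qed.

End Weighted.
End AcyclicRecurrence.

(** * Homogeneous q-binomial coefficients as sums over subsets of fixed size *)

Section HomogeneousQBinomial.
Variables (R : comNzRingType) (a b : R).

(* [homq k = (a ^ k - b ^ k) / (a - b)], the homogeneous q-integer. *)
Definition homq k : R := \sum_(i < k) a ^+ i * b ^+ (k.-1 - i).

Definition homq_fact k : R := \prod_(i < k) homq i.+1.

Lemma homq_factS k : homq_fact k.+1 = homq_fact k * homq k.+1.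
Proof. by rewrite /homq_fact big_ord_recr. Qed.

(** Split the sum at index [m]: the first [m] terms share [b ^+ k], the others [a ^+ m]. *)
Lemma homqD m k : homq (m + k) = a ^+ m * homq k + b ^+ k * homq m.
Proof.
rewrite /homq big_split_ord /= addrC !mulr_sumr; congr (_ + _); apply: eq_bigr.
  by move=> i _; rewrite exprD -mulrA; congr (_ * (_ * b ^+ _)); lia.
move=> [i /= lt_im] _; rewrite mulrCA -exprD; congr (_ * b ^+ _); lia.
Qed.

Variable n : nat.
Implicit Types S V : {set 'I_n}.

Definition cut_weight S V : R :=
  \prod_(s in S) \prod_(t in V) (if (t < s)%N then a else b).

(** A q-Pascal rule, by whether the maximum [m] lies in [S]. If so, all pairs from [m] to [V :\: S]
    descend and give [a]; if not, each element of [S] lies below [m] and gives one factor [b]. *)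
Lemma sum_cut_weight_recr k (m : 'I_n) V :
    m \in V -> (forall s, s \in V -> (s <= m)%N) -> (k < #|V|)%N ->
  \sum_(S : {set 'I_n} | (S \subset V) && (#|S| == k.+1)) cut_weight S (V :\: S) =
    a ^+ (#|V|.-1 - k) *
      \sum_(S : {set 'I_n} | (S \subset V :\ m) && (#|S| == k))
        cut_weight S (V :\ m :\: S)
    + b ^+ k.+1 *
      \sum_(S : {set 'I_n} | (S \subset V :\ m) && (#|S| == k.+1))
        cut_weight S (V :\ m :\: S).
Proof.
move=> mV max_m lt_kV; rewrite (bigID (fun S => m \in S)) /=; congr (_ + _).
  rewrite (reindex_onto (fun S => m |: S) (fun S => S :\ m)) /=; last first.
    by move=> S /andP[_ mS]; rewrite setD1K.
  rewrite mulr_sumr; apply: eq_big => [S | S /andP[/andP[/andP[sSV cS] _] /eqP eqS]].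
    rewrite subUset sub1set mV setU11 andbT /=.
    have [mS | nmS] := boolP (m \in S).
      rewrite subsetD1 mS /= andbF; apply/negbTE.
      apply/negP => /andP[_ /eqP/setP/(_ m)].
      by rewrite !inE eqxx mS.
    by rewrite setU1K // eqxx andbT cardsU1 nmS eqSS subsetD1 nmS andbT.
  have nmS : m \notin S by rewrite -eqS !inE eqxx.
  rewrite /cut_weight big_setU1 //= setDDl; congr (_ * _).
  rewrite -setDDl (eq_bigr (fun=> a)) => [|t]; last first.
    rewrite !inE => /and3P[_ ntm tV].
    by rewrite ltn_neqAle ntm max_m.
  rewrite prodr_const cardsD.
  have sSV' : S \subset V :\ m.
    by rewrite subsetD1 nmS andbT (subset_trans _ sSV) ?subsetUr.
  rewrite (setIidPr sSV'); congr (a ^+ _).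
  move: cS; rewrite cardsU1 nmS add1n eqSS => /eqP ->.
  by rewrite (cardsD1 m V) mV.
rewrite mulr_sumr; apply: eq_big => [S | S /andP[/andP[sSV /eqP cS] nmS]].
  by rewrite subsetD1 -!andbA; congr (_ && _); exact: andbC.
rewrite /cut_weight -cS -prodr_const -big_split /=; apply: eq_bigr => s sS.
have mVS : m \in V :\: S by rewrite inE nmS.
rewrite (big_setD1 m) //= ltnNge max_m ?(subsetP sSV) //=; congr (_ * _).
by apply: eq_bigl => t; rewrite !inE andbCA.
Qed.

(** The quotient of q-factorials is cleared of denominators, since [R] is only a ring. Induction on
    [#|V|] removes the maximum. *)
Lemma sum_cut_weight V k : (k <= #|V|)%N ->
  (\sum_(S : {set 'I_n} | (S \subset V) && (#|S| == k)) cut_weight S (V :\: S)) *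
    (homq_fact k * homq_fact (#|V| - k)) = homq_fact #|V|.
Proof.
have cut0 (W : {set 'I_n}) :
    (\sum_(S : {set 'I_n} | (S \subset W) && (#|S| == 0%N)) cut_weight S (W :\: S)) *
      (homq_fact 0 * homq_fact (#|W| - 0)) = homq_fact #|W|.
  rewrite (big_pred1 set0) => [|S].
    by rewrite /cut_weight big_set0 {1}/homq_fact big_ord0 !mul1r subn0.
  by rewrite cards_eq0 andbC /=; case: eqP => // ->; rewrite sub0set.
move: {2}#|V| (erefl #|V|) => N; elim: N V k => [|N IHN] V [|k] cV le_kV.
- exact: cut0.
- by rewrite cV in le_kV.
- exact: cut0.
have /set0Pn[x0 x0V] : V != set0 by rewrite -cards_eq0 cV.
case: (arg_maxnP (fun i : 'I_n => i : nat) x0V) => m mV max_m.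
have cV' : #|V :\ m| = N by have := cardsD1 m V; rewrite [m \in V]mV cV => -[].
rewrite (sum_cut_weight_recr mV max_m) // cV /= subSS.
have le_kN : (k <= N)%N by rewrite -ltnS -cV.
have IHk := IHN (V :\ m) k cV'; rewrite cV' in IHk; have {}IHk := IHk le_kN.
(* Splitting [N.+1] as [N - k] plus [k.+1] produces the coefficients [a ^+ (N - k)] and [b ^+ k.+1]
   of the Pascal rule. *)
rewrite [homq_fact N.+1]homq_factS -[in homq N.+1](subnK le_kN) -addnS homqD.
rewrite homq_factS mulrDr -{1}IHk.
have [lt_kN | ge_kN] := ltnP k N.
  have := IHN (V :\ m) k.+1 cV'; rewrite cV' => /(_ lt_kN) <-.
  rewrite -(subnSK lt_kN) !homq_factS; ring.
(* Here the second Pascal term is an empty sum, and [homq 0 = 0] removes its counterpart. *)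
have {le_kN ge_kN} -> : k = N by apply/eqP; rewrite eqn_leq le_kN.
rewrite subnn [X in b ^+ _ * X]big_pred0 => [|S].
  have -> : homq 0 = 0 by rewrite /homq big_ord0.
  ring.
by apply/negP => /andP[/subset_leq_card + /eqP cS]; rewrite cS cV' ltnn.
Qed.

End HomogeneousQBinomial.

(** Grouping subsets by size, [sum_cut_weight] lets [homq_fact] play the role of [n!] in a product
    of exponential generating functions. *)
Lemma sum_subset_fps_mul (K : fieldType) (a b : K) n (f g : nat -> K)
    (V : {set 'I_n}) :
  \sum_(S : {set 'I_n} | S \subset V)
     homq_fact a b #|S| * f #|S| *
     (cut_weight a b S (V :\: S) * (homq_fact a b #|V :\: S| * g #|V :\: S|)) =
  homq_fact a b #|V| * fps_mul f g #|V|.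
Proof.
pose c (S : {set 'I_n}) : 'I_(#|V|.+1) := inord #|S|.
rewrite (partition_big c predT) //= /fps_mul mulr_sumr; apply: eq_bigr => k _.
have le_kV : (k <= #|V|)%N by rewrite -ltnS.
rewrite -{1}(sum_cut_weight a b le_kV) -!mulrA mulr_suml.
apply: eq_big => [S | S /andP[sSV /eqP cS]].
  apply: andb_id2l => sSV; rewrite -val_eqE /= inordK // ltnS.
  exact: subset_leq_card.
have {}cS : #|S| = k.
  by rewrite -cS inordK // ltnS subset_leq_card.
rewrite cardsD (setIidPr sSV) cS; ring.
Qed.

(** * Generating series over a field *)

Section AcyclicSeries.
Variables (K : fieldType) (u y : K).
Let a := 1 + u * y.
Let b := 1 + y.

(** With [q = a / b], [homq k] is [b ^+ k.-1] times the q-integer of [k]; the exponents of [b] add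
    up to ['C(n, 2)]. *)
Lemma homq_fact_qfact n : b != 0 ->
  homq_fact a b n = qfact (a / b) n * b ^+ 'C(n, 2).
Proof.
move=> b0; elim: n => [|n IHn].
  by rewrite /homq_fact /qfact big_ord0 big_nil mulr1.
rewrite homq_factS IHn /qfact [in RHS]big_nat_recr //= binS bin1 exprD -!mulrA.
congr (_ * _); rewrite mulrCA; congr (_ * _).
rewrite mulr_suml; apply: eq_bigr => i _.
have le_in : (i <= n)%N by rewrite -ltnS.
have -> : b ^+ n = b ^+ i * b ^+ (n - i) by rewrite -exprD subnKC.
by rewrite expr_div_n mulrA divfK ?expf_neq0.
Qed.

(** Chosen so that the product over [D] is [u ^+ des D * y ^+ edges D] and [1 + edge_weight e] is
    [a] or [b]. *)
Definition edge_weight n (e : 'I_n * 'I_n) : K :=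
  (if (e.2 < e.1)%N then u else 1) * y.

Lemma acyclic_enumE n z :
  acyclic_enum n u y z = acyclic_sum (@edge_weight n) setT z.
Proof.
apply: eq_big => [D | D _].
  rewrite (_ : D \subset _); last by apply/subsetP => e _; rewrite !inE.
  by apply/andb_idl/acyclic_digraph.
have -> : #|sources setT D| = so D by apply: eq_card => t; rewrite !inE.
congr (_ * _).
rewrite big_split /= prodr_const -big_mkcondr /=; congr (_ * _).
by rewrite -prodr_const; apply: eq_bigl => e; rewrite !inE.
Qed.

Lemma prod_edge_weight n (S V : {set 'I_n}) :
  \prod_(e in setX S V) (1 + edge_weight e) = cut_weight a b S V.
Proof.
rewrite /cut_weight pair_big /=; apply: eq_big => [e | e _]; first by rewrite inE.
by rewrite /edge_weight; case: ifP; rewrite ?mul1r.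
Qed.

Hypothesis b_neq0 : b != 0.
Hypothesis homq_neq0 : forall k, homq a b k.+1 != 0.

Let E (z : K) := graphic_egf (a / b) y (fun n => z ^+ n).

Lemma homq_fact_neq0 k : homq_fact a b k != 0.
Proof. by apply/prodf_neq0 => i _; exact: homq_neq0. Qed.

Lemma homq_factK z n : homq_fact a b n * E z n = z ^+ n.
Proof.
by rewrite /E /graphic_egf -/b -homq_fact_qfact // mulrC divfK ?homq_fact_neq0.
Qed.

Lemma E0_neq0 z : E z 0 != 0.
Proof.
have := oner_neq0 K; rewrite -[1](homq_factK z 0) mulf_eq0 negb_or.
by case/andP.
Qed.

(** At [z = 0] the recurrence over sets of sources becomes the recursion that determines the inverse
    series. *)
Lemma acyclic_sum_fps_inv n (V : {set 'I_n}) :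
  acyclic_sum (@edge_weight n) V 1 = homq_fact a b #|V| * fps_inv (E (-1)) #|V|.
Proof.
have [N] := ubnP #|V|; elim: N V => // N IHN V /ltnSE le_VN.
(* Both sides are 1 for empty [V] and 0 otherwise: the left because a source exists, the right as a
   coefficient of the series 1. *)
have eqV : acyclic_sum (@edge_weight n) V 0 =
    homq_fact a b #|V| * fps_mul (E (-1)) (fps_inv (E (-1))) #|V|.
  rewrite acyclic_sum0 fps_mulV ?E0_neq0 // /fps_one cards_eq0.
  by case: eqP => [->|_]; rewrite ?mulr0 // cards0 /homq_fact big_ord0 mulr1.
rewrite acyclic_sum_rec -sum_subset_fps_mul in eqV.
(* The term [S = set0] holds the unknown value at [V]; the others involve smaller sets and agree by
   induction. *)
rewrite !(bigD1 (P := fun S => S \subset V) set0) ?sub0set //= in eqV.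
rewrite setD0 cards0 homq_factK sub0r !expr0 !mul1r prod_edge_weight in eqV.
rewrite /cut_weight big_set0 !mul1r in eqV.
move: eqV; set rest := (X in _ + X = _); set rest' := (X in _ = _ + X).
suff -> : rest = rest' by move/addIr.
apply: eq_bigr => S /andP[sSV S0].
rewrite homq_factK prod_edge_weight IHN //.
apply: leq_trans le_VN; rewrite -(cardsID S V) (setIidPr sSV) -[X in (X < _)%N]add0n.
by rewrite ltn_add2r card_gt0.
Qed.

Lemma acyclic_enum_series z :
  graphic_egf (a / b) y (fun n => acyclic_enum n u y z) =1
    fps_div (E (z - 1)) (E (-1)).
Proof.
move=> n; rewrite /graphic_egf -/b -homq_fact_qfact // acyclic_enumE.
apply: (mulIf (homq_fact_neq0 n)); rewrite divfK ?homq_fact_neq0 // mulrC.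
have := sum_subset_fps_mul a b (E (z - 1)) (fps_inv (E (-1))) [set: 'I_n].
rewrite cardsT card_ord => <-; rewrite acyclic_sum_rec.
by apply: eq_bigr => S _; rewrite homq_factK prod_edge_weight acyclic_sum_fps_inv.
Qed.

Lemma acyclic_enum_series1 :
  graphic_egf (a / b) y (fun n => acyclic_enum n u y 1) =1 fps_inv (E (-1)).
Proof.
move=> n; rewrite /graphic_egf -/b -homq_fact_qfact // acyclic_enumE.
by rewrite acyclic_sum_fps_inv cardsT card_ord mulrC mulKf ?homq_fact_neq0.
Qed.

End AcyclicSeries.

(** * Nonvanishing of the denominators in [Quya], and the conclusion *)

Lemma homq_fraction_neq0 k :
  homq (1 + u_var * y_var) (1 + y_var) k.+1 != 0.
Proof.
rewrite /homq /u_var /y_var -(tofrac1 {mpoly rat[3]}) -tofracM -!tofracD.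
under eq_bigr do rewrite -!tofracXn -tofracM.
rewrite -rmorph_sum tofrac_eq0.
(* At [u = y = 0] the homogeneous [k]-integer takes the value [k]. *)
apply/eqP => /(congr1 (meval (fun=> 0))) /eqP.
rewrite meval0 raddf_sum /= (eq_bigr (fun=> 1)) => [|i _]; last first.
  rewrite mevalM !rmorphXn !rmorphD rmorphM /= !mevalXU meval1.
  by rewrite mulr0 addr0 !expr1n mulr1.
by rewrite sumr_const card_ord pnatr_eq0.
Qed.

Lemma one_plus_y_neq0 : 1 + y_var != 0.
Proof.
rewrite /y_var -(tofrac1 {mpoly rat[3]}) -tofracD tofrac_eq0.
apply/eqP => /(congr1 (meval (fun=> 0))) /eqP.
by rewrite meval0 mevalD mevalXU meval1 addr0 oner_eq0.
Qed.

Theorem theorem4p2 :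
  let u := u_var in
  let y := y_var in
  let alpha := alpha_var in
  let q := (1 + u * y) / (1 + y) in
  let A := graphic_egf q y (fun n => acyclic_enum n u y 1) in
  A =1 fps_inv (graphic_egf q y (fun n => (-1) ^+ n))
  /\ graphic_egf q y (fun n => acyclic_enum n u y alpha)
       =1 fps_div (graphic_egf q y (fun n => (alpha - 1) ^+ n))
                  (graphic_egf q y (fun n => (-1) ^+ n)).
Proof.
split.
  exact: acyclic_enum_series1 one_plus_y_neq0 homq_fraction_neq0.
exact: acyclic_enum_series one_plus_y_neq0 homq_fraction_neq0 _.
Qed.
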